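(* Let $\Sigma$ be the set of possible states of a student, $A_s$ and $A_t$ the finite nonempty sets of actions of the student and the teacher, $u:A_s\to\mathbb{R}$ the value the teacher places on student actions, and $0<\gamma_0<1$ a discount factor. Suppose that: (1) the student's new state is $\tau(s,a_s,a_t)$, where $\tau:\Sigma\times A_s\times A_t\to\Sigma$ is a function of the student's old state $s$ and the current joint action $(a_s,a_t)$; (2) the student's action is a stochastic function of his current state, action $a$ being chosen at state $s$ with probability $\rho(s,a)$; (3) the teacher knows the student's current state. Then the optimal teaching policy is given by the $\gamma_0$-optimal policy in the Markov decision process $\mathrm{TMDP}=\langle\Sigma,A_t,P,U\rangle$, where $$P(s,s',a_t)=\sum_{a_s\in A_s}\rho(s,a_s)\,\delta_{s',\tau(s,a_s,a_t)},\qquad U(s)=\sum_{a_s\in A_s}\rho(s,a_s)\,u(a_s).$$ That is, if $\pi$ is a $\gamma_0$-optimal policy in $\mathrm{TMDP}$, then for every initial state of the student, $\pi$ maximizes $\mathrm{val}(\cdot)$ over all teaching policies.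
   Context: A teacher and a student interact repeatedly; at each iteration $k=0,1,2,\dots$ the student chooses an action in $A_s$ and the teacher chooses an action in $A_t$. Given the student's current state, the student's action is drawn according to $\rho(s,\cdot)$, a probability distribution on $A_s$, independently of the teacher's current action. A teaching policy is a function that returns a teacher action at each iteration; it may depend on the complete history of past joint actions (and on the student's current state, which the teacher knows). Given the student's initial state, a teaching policy $\pi$ induces a probability distribution $Pr_{\pi,k}$ over the student's actions at time $k$. The value of $\pi$ is $$\mathrm{val}(\pi)=\sum_{k=0}^{\infty}\gamma_0^k\,E_k(u),\qquad E_k(u)=\sum_{a\in A_s}Pr_{\pi,k}(a)\,u(a).$$ An optimal teaching policy is one that maximizes $\mathrm{val}$. A Markov decision process is a tuple $\langle S,A,P,r\rangle$ with state space $S$, action set $A$, transition probabilities $P:S\times S\times A\to[0,1]$ ($P(s,s',a)$ is the probability of moving from $s$ to $s'$ under action $a$), and reward function $r:S\to\mathbb{R}$. For an initial state $s$ and a policy $\pi$ (a function assigning an action to each state), $P_{s,\pi,k}(s')$ is the probability that the $k$-th state is $s'$ when starting from $s$ (with $k=0$ the initial state) and following $\pi$. A $\gamma_0$-optimal policy is a policy $\pi$ that maximizes, simultaneously at each state $s$, $$\sum_{k=0}^{\infty}\gamma_0^k\Big(\sum_{s'\in S}P_{s,\pi,k}(s')\,r(s')\Big).$$ Here $\delta_{i,j}=1$ if $i=j$ and $0$ otherwise. *)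

(* Defs.v *)
From HB Require Import structures.
From mathcomp Require Import all_boot all_order all_algebra.
From mathcomp Require Import all_classical all_reals all_analysis.

Set Implicit Arguments.
Unset Strict Implicit.
Unset Printing Implicit Defensive.

Import Order.TTheory GRing.Theory Num.Theory.
Import numFieldNormedType.Exports.

Local Open Scope classical_set_scope.
Local Open Scope ring_scope.

Record fdist (R : realType) (A : finType) := FDist {
  fdist_fun :> A -> R;
  fdist_ge0 : forall a, 0 <= fdist_fun a;
  fdist_sum1 : \sum_(a : A) fdist_fun a = 1 }.

Definition expect (R : realType) (A : finType) (p : A -> R) (u : A -> R) : R :=
  \sum_(a : A) p a * u a.

(* [limn] is total. In both uses below the [x k] are uniformly bounded (for
   decision processes: as soon as the reward function is bounded), so for
   0 <= gamma < 1 the series converges absolutely and this is its sum. *)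
Definition discounted_sum (R : realType) (gamma : R) (x : nat -> R) : R :=
  limn (series (fun k => gamma ^+ k * x k)).

(* The state space is an arbitrary set, not necessarily finite; transitions are
   finitely supported, so that the sums over all states are finite sums, as
   \sum_(s' \in setT) requires.  When S is finite, mdp_fin is vacuous.  The
   bound P <= 1 follows from the other fields.  The argument order is that of
   P(s, s', a): old state, new state, action. *)
Record mdp (R : realType) (S : choiceType) (A : Type) := MDP {
  mdp_P : S -> S -> A -> R;
  mdp_r : S -> R;
  mdp_ge0 : forall s s' a, 0 <= mdp_P s s' a;
  mdp_fin : forall s a, finite_set [set s' | mdp_P s s' a != 0];
  mdp_sum1 : forall s a, \sum_(s' \in setT) mdp_P s s' a = 1 }.

Fixpoint mdp_state_prob (R : realType) (S : choiceType) (A : Type)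
    (M : mdp R S A) (s : S) (pi : S -> A) (k : nat) (s' : S) : R :=
  match k with
  | 0 => (s' == s)%:R
  | j.+1 => \sum_(s'' \in [set: S])
              mdp_state_prob M s pi j s'' * mdp_P M s'' s' (pi s'')
  end.

Definition mdp_value (R : realType) (S : choiceType) (A : Type)
    (M : mdp R S A) (gamma : R) (pi : S -> A) (s : S) : R :=
  discounted_sum gamma (fun k =>
    \sum_(s' \in [set: S]) mdp_state_prob M s pi k s' * mdp_r M s').

Definition gamma_optimal (R : realType) (S : choiceType) (A : Type)
    (M : mdp R S A) (gamma : R) (pi : S -> A) : Prop :=
  forall (s : S) (pi' : S -> A), mdp_value M gamma pi' s <= mdp_value M gamma pi s.

(* A history lists the past joint actions (student, teacher), oldest first; its
   length is the current iteration.  The second argument of a teaching policy is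
   the student's current state. *)
Definition teaching_policy (Sigma : Type) (As At : finType) : Type :=
  seq (As * At) -> Sigma -> At.

Definition state_policy (Sigma : Type) (As At : finType) (pi : Sigma -> At) :
    teaching_policy Sigma As At :=
  fun _ s => pi s.

Definition state_after (Sigma : Type) (As At : finType)
    (tau : Sigma -> As -> At -> Sigma) (s : Sigma) (h : seq (As * At)) : Sigma :=
  foldl (fun s' x => tau s' x.1 x.2) s h.

(* At each iteration i < k the student draws the action with law rho at the
   current state, and the teacher's action is the one prescribed by the policy. *)
Definition history_prob (R : realType) (Sigma : Type) (As At : finType)
    (tau : Sigma -> As -> At -> Sigma) (rho : Sigma -> fdist R As)
    (pi : teaching_policy Sigma As At) (s : Sigma)
    (k : nat) (h : k.-tuple (As * At)) : R :=
  \prod_(i < k)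
    (let past := take i h in
     let cur := state_after tau s past in
     rho cur (tnth h i).1 * ((tnth h i).2 == pi past cur)%:R).

Definition student_action_prob (R : realType) (Sigma : Type) (As At : finType)
    (tau : Sigma -> As -> At -> Sigma) (rho : Sigma -> fdist R As)
    (pi : teaching_policy Sigma As At) (s : Sigma) (k : nat) (a : As) : R :=
  \sum_(h : k.-tuple (As * At))
    history_prob tau rho pi s h * rho (state_after tau s h) a.

Definition val_policy (R : realType) (Sigma : Type) (As At : finType)
    (tau : Sigma -> As -> At -> Sigma) (rho : Sigma -> fdist R As)
    (u : As -> R) (gamma : R) (pi : teaching_policy Sigma As At) (s : Sigma) : R :=
  discounted_sum gamma (fun k => expect (student_action_prob tau rho pi s k) u).

Definition tmdp_P (R : realType) (Sigma : choiceType) (As At : finType)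
    (tau : Sigma -> As -> At -> Sigma) (rho : Sigma -> fdist R As)
    (s s' : Sigma) (t : At) : R :=
  \sum_(a : As) rho s a * (s' == tau s a t)%:R.

Lemma tmdp_ge0 (R : realType) (Sigma : choiceType) (As At : finType)
    (tau : Sigma -> As -> At -> Sigma) (rho : Sigma -> fdist R As) s s' t :
  0 <= tmdp_P tau rho s s' t.
Proof. by apply: sumr_ge0 => a _; rewrite mulr_ge0 ?fdist_ge0 ?ler0n. Qed.

Lemma tmdp_support (R : realType) (Sigma : choiceType) (As At : finType)
    (tau : Sigma -> As -> At -> Sigma) (rho : Sigma -> fdist R As) s s' t :
  tmdp_P tau rho s s' t != 0 -> s' \in [seq tau s a t | a : As].
Proof.
apply: contraR => s'N; apply/eqP/big1 => a _.
case: eqP => [s'E|_]; last by rewrite mulr0.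
by case/negP: s'N; apply/mapP; exists a; rewrite ?mem_enum.
Qed.

Lemma tmdp_fin (R : realType) (Sigma : choiceType) (As At : finType)
    (tau : Sigma -> As -> At -> Sigma) (rho : Sigma -> fdist R As) s t :
  finite_set [set s' | tmdp_P tau rho s s' t != 0].
Proof.
apply: (sub_finite_set _ (finite_seq [seq tau s a t | a : As])) => s' /=.
exact: tmdp_support.
Qed.

Lemma tmdp_sum1 (R : realType) (Sigma : choiceType) (As At : finType)
    (tau : Sigma -> As -> At -> Sigma) (rho : Sigma -> fdist R As) s t :
  \sum_(s' \in setT) tmdp_P tau rho s s' t = 1.
Proof.
rewrite -(@fsbig_widen _ _ _ _ [set` undup [seq tau s a t | a : As]] setT) //.
- rewrite -fsbig_seq ?undup_uniq // exchange_big /= -[RHS](fdist_sum1 (rho s)).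
  apply: eq_bigr => a _; rewrite (bigD1_seq (tau s a t)) ?undup_uniq //=.
    rewrite eqxx mulr1 big1 ?addr0 // => s' /negPf ->.
    by rewrite mulr0.
  by rewrite mem_undup; apply/mapP; exists a; rewrite ?mem_enum.
- move=> s' [_] /= s'N; apply/eqP/negPn/negP => /tmdp_support s'E.
  by apply: s'N; rewrite mem_undup.
Qed.

Definition TMDP (R : realType) (Sigma : choiceType) (As At : finType)
    (tau : Sigma -> As -> At -> Sigma) (rho : Sigma -> fdist R As)
    (u : As -> R) : mdp R Sigma At :=
  {| mdp_P := tmdp_P tau rho;
     mdp_r := fun s => expect (rho s) u;
     mdp_ge0 := tmdp_ge0 tau rho;
     mdp_fin := tmdp_fin tau rho;
     mdp_sum1 := tmdp_sum1 tau rho |}.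

(* Main.v *)
(* Conditioning on the first joint action gives, for an arbitrary teaching policy,
   val(sigma)(s) = U(s) + gamma0 E[val(sigma')(s')], where s' is the next state and
   sigma' is sigma with the first joint action fixed as past.  Hence any bounded V
   with U(s) + gamma0 E[V(s')] <= V(s) for every action dominates the value of all
   history-dependent policies: the defect V - val contracts by gamma0 < 1.
   The value V of a gamma0-optimal stationary policy satisfies this inequality,
   since otherwise a one-state deviation would be a strictly better stationary
   policy. *)
Require Import Defs.
From HB Require Import structures.
From mathcomp Require Import all_boot all_order all_algebra.
From mathcomp Require Import all_classical all_reals all_analysis.

Set Implicit Arguments.
Unset Strict Implicit.
Unset Printing Implicit Defensive.

Import Order.TTheory GRing.Theory Num.Theory.
Import numFieldNormedType.Exports.

Local Open Scope ring_scope.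

(** * Discounted sums of bounded sequences *)

Section DiscountedSum.
Context (R : realType) (gamma : R).
Hypotheses (gamma_gt0 : 0 < gamma) (gamma_lt1 : gamma < 1).
Implicit Types (x : nat -> R) (M : R).

Let normg_lt1 : `|gamma| < 1. Proof. by rewrite gtr0_norm. Qed.

Lemma normr_discounted_le x M (xM : forall k, `|x k| <= M) (k : nat) :
  `|gamma ^+ k * x k| <= geometric M gamma k.
Proof.
by rewrite normrM normrX gtr0_norm // mulrC ler_wpM2r // exprn_ge0 // ltW.
Qed.

Lemma is_cvg_discounted_norm x M (xM : forall k, `|x k| <= M) :
  cvgn [normed series (fun k => gamma ^+ k * x k)].
Proof.
apply: (@series_le_cvg _ _ (geometric M gamma)) => [k|k|k|] //=.
- exact: le_trans (normr_discounted_le xM k).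
- exact: normr_discounted_le.
- exact: is_cvg_geometric_series.
Qed.

Lemma is_cvg_discounted x M (xM : forall k, `|x k| <= M) :
  cvgn (series (fun k => gamma ^+ k * x k)).
Proof. exact: normed_cvg (is_cvg_discounted_norm xM). Qed.

Lemma discounted_sum_bounded x M (xM : forall k, `|x k| <= M) :
  `|discounted_sum gamma x| <= M / (1 - gamma).
Proof.
have cvg_norm := is_cvg_discounted_norm xM.
have /cvg_lim <- // := @cvg_geometric_series _ M _ normg_lt1.
apply: le_trans (lim_series_norm cvg_norm) _; apply: lim_series_le => // [|k].
- exact: is_cvg_geometric_series.
- exact: normr_discounted_le.
Qed.

(** Split off the term of index 0 and factor [gamma] out of the rest. The uniform bound makes each
    series in [y i] converge, so the limit passes through the finite sum over [I]. *)
Lemma discounted_sumS (I : finType) (w : I -> R) x (y : I -> nat -> R) M :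
    (forall i k, `|y i k| <= M) -> (forall k, x k.+1 = \sum_i w i * y i k) ->
  discounted_sum gamma x = x 0%N + gamma * \sum_i w i * discounted_sum gamma (y i).
Proof.
move=> yM xS; apply: cvg_lim => //; rewrite -cvg_shiftS.
have -> : (fun n => series (fun k => gamma ^+ k * x k) n.+1) =
    (fun n => x 0%N + gamma * \sum_i w i * series (fun k => gamma ^+ k * y i k) n).
  apply/funext => n; rewrite /series /= big_nat_recl //= expr0 mul1r; congr (_ + _).
  under [in RHS]eq_bigr do rewrite mulr_sumr.
  rewrite exchange_big /= mulr_sumr; apply: eq_bigr => k _.
  rewrite xS exprS -mulrA; congr (_ * _); rewrite mulr_sumr.
  by apply: eq_bigr => i _; rewrite mulrCA.
apply: cvgD; first exact: cvg_cst.
apply: cvgMl_tmp.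
apply: cvg_big => [|i _]; first exact: add_continuous.
by apply: cvgMl_tmp; exact: (is_cvg_discounted (yM i)).
Qed.

(** Feeding the bound back into the step hypothesis [n] times gives [- (C * gamma ^+ n) <= D z], and
    the left side tends to 0. The step concerns all of [X] at once, since a recursion may move to
    another point. *)
Lemma nonneg_of_discounted (X : Type) (D : X -> R) (C : R) :
    (forall z, - C <= D z) ->
    (forall c, (forall z, - c <= D z) -> forall z, - (gamma * c) <= D z) ->
  forall z, 0 <= D z.
Proof.
move=> DC step z.
have lb n : - (C * gamma ^+ n) <= D z.
  elim: n z => [|n IHn] z; first by rewrite expr0 mulr1.
  by rewrite exprS mulrCA; apply: step.
have cvg0 : (((fun n => - geometric C gamma n) : nat -> R) @ \oo --> (- 0 : R))%classic.
  by apply: cvgN; exact: cvg_geometric.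
rewrite -oppr0 -(cvg_lim _ cvg0) //; apply: limr_le; first by apply/cvg_ex; exists (- 0).
by near=> n; exact: lb.
Unshelve. all: by end_near. Qed.

End DiscountedSum.

(** * Finite expectations and sums over tuples *)

Lemma normr_expect_le (R : realType) (A : finType) (p : fdist R A) (f : A -> R) (M : R) :
  (forall a, `|f a| <= M) -> `|expect p f| <= M.
Proof.
move=> fM; rewrite -[M]mul1r -(fdist_sum1 p) mulr_suml.
apply: (le_trans (ler_norm_sum _ _ _)); apply: ler_sum => a _.
by rewrite normrM ger0_norm ?fdist_ge0 // ler_wpM2l ?fdist_ge0.
Qed.

Lemma ler_expect (R : realType) (A : finType) (p : fdist R A) (f g : A -> R) :
  (forall a, f a <= g a) -> expect p f <= expect p g.
Proof. by move=> fg; apply: ler_sum => a _; rewrite ler_wpM2l ?fdist_ge0. Qed.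

Lemma expect_cst (R : realType) (A : finType) (p : fdist R A) (c : R) :
  expect p (fun=> c) = c.
Proof. by rewrite /expect -mulr_suml fdist_sum1 mul1r. Qed.

Lemma expectB (R : realType) (A : finType) (p f g : A -> R) :
  expect p (fun a => f a - g a) = expect p f - expect p g.
Proof. by rewrite /expect -sumrB; apply: eq_bigr => a _; rewrite mulrBr. Qed.

Lemma sum_tuple_cons (V : nmodType) (T : finType) (k : nat) (F : k.+1.-tuple T -> V) :
  \sum_(h : k.+1.-tuple T) F h = \sum_(x : T) \sum_(h : k.-tuple T) F [tuple of x :: h].
Proof.
rewrite pair_bigA /= (reindex (fun p : T * k.-tuple T => [tuple of p.1 :: p.2])) //=.
exists (fun h => (thead h, [tuple of behead h])) => [[x h] _|h _] /=.
  by congr (_, _); apply: val_inj.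
by rewrite -tuple_eta.
Qed.

(** * Expectations over histories *)

Section Teaching.
Context (R : realType) (Sigma : choiceType) (As At : finType).
Context (tau : Sigma -> As -> At -> Sigma) (rho : Sigma -> fdist R As).
Implicit Types (sigma : teaching_policy Sigma As At) (s : Sigma) (f : Sigma -> R).

(** A general [f] serves twice: the expected immediate reward gives [val_policy], and indicators of
    states give [mdp_state_prob]. *)
Definition expect_after sigma (k : nat) f s : R :=
  \sum_(h : k.-tuple (As * At)) history_prob tau rho sigma s h * f (state_after tau s h).

(** The continuation is again a history-dependent policy, so recursions stay within this class. *)
Definition policy_after sigma (x : As * At) : teaching_policy Sigma As At :=
  fun h => sigma (x :: h).

Lemma history_prob_cons sigma s (k : nat) (x : As * At) (h : k.-tuple (As * At)) :
  history_prob tau rho sigma s [tuple of x :: h] =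
  rho s x.1 * (x.2 == sigma [::] s)%:R *
    history_prob tau rho (policy_after sigma x) (tau s x.1 x.2) h.
Proof.
rewrite /history_prob big_ord_recl /= tnth0; congr (_ * _).
by apply: eq_bigr => i _; rewrite tnthS.
Qed.

Lemma expect_after0 sigma f s : expect_after sigma 0 f s = f s.
Proof.
rewrite /expect_after (big_pred1 [tuple]) => [|h]; last by rewrite [h]tuple0 /= eqxx.
by rewrite /history_prob big_ord0 mul1r.
Qed.

Lemma expect_afterS sigma (k : nat) f s (t := sigma [::] s) :
  expect_after sigma k.+1 f s =
  expect (rho s) (fun a => expect_after (policy_after sigma (a, t)) k f (tau s a t)).
Proof.
rewrite /expect_after sum_tuple_cons.
pose F x := \sum_(h : k.-tuple (As * At)) history_prob tau rho sigma s [tuple of x :: h] *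
  f (state_after tau s [tuple of x :: h]).
rewrite (eq_bigr (fun x => F (x.1, x.2))) => [|[] //].
rewrite -(pair_bigA _ (fun a t => F (a, t))) /F /=.
(* Only the prescribed action [t] has nonzero weight among the teacher's first actions. *)
apply: eq_bigr => a _; rewrite (bigD1 t) //= [X in _ + X]big1 => [|t' t'N].
  rewrite addr0 mulr_sumr; apply: eq_bigr => h _.
  by rewrite history_prob_cons /= eqxx mulr1 mulrA.
by apply: big1 => h _; rewrite history_prob_cons /= (negPf t'N) mulr0 !mul0r.
Qed.

Lemma normr_expect_after_le sigma (k : nat) f s (M : R) :
  (forall s, `|f s| <= M) -> `|expect_after sigma k f s| <= M.
Proof.
move=> fM; elim: k sigma s => [|k IHk] sigma s; first by rewrite expect_after0.
by rewrite expect_afterS; apply: normr_expect_le => a; exact: IHk.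
Qed.

(** * Stationary policies and the decision process *)

Lemma expect_student_action_prob sigma s (k : nat) (u : As -> R) :
  expect (student_action_prob tau rho sigma s k) u =
  expect_after sigma k (fun s => expect (rho s) u) s.
Proof.
rewrite /expect /student_action_prob.
under eq_bigr do rewrite mulr_suml.
rewrite exchange_big /=; apply: eq_bigr => h _; rewrite mulr_sumr.
by apply: eq_bigr => a _; rewrite mulrA.
Qed.

(** [expect_afterS] peels off the first step, while [mdp_state_prob] recurses on the last one. The
    induction goes through because a stationary policy is its own continuation. *)
Lemma expect_after_stateS (pi : Sigma -> At) (k : nat) f s :
  expect_after (state_policy pi) k.+1 f s =
  expect_after (state_policy pi) k (fun s => expect (rho s) (fun a => f (tau s a (pi s)))) s.
Proof.
elim: k s => [|k IHk] s.
  by rewrite expect_afterS !expect_after0; apply: eq_bigr => a _; rewrite expect_after0.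
by rewrite expect_afterS [RHS]expect_afterS; apply: eq_bigr => a _; rewrite -IHk.
Qed.

(** Change of variables for the image of the weights [w] under [y], which is supported on the finite
    range of [y]. It is applied with [I] the histories of length [k]. *)
Lemma fsbig_pushforward (I : finType) (w : I -> R) (y : I -> Sigma) f :
  \sum_(s \in [set: Sigma]) (\sum_i w i * (s == y i)%:R) * f s = \sum_i w i * f (y i).
Proof.
rewrite -(@fsbig_widen _ _ _ _ [set` undup [seq y i | i : I]]%classic setT) //.
- rewrite -fsbig_seq ?undup_uniq //.
  under eq_bigr do rewrite mulr_suml.
  rewrite exchange_big /=; apply: eq_bigr => i _.
  rewrite (bigD1_seq (y i)) ?undup_uniq //=; last first.
    by rewrite mem_undup; apply/mapP; exists i; rewrite ?mem_enum.
  rewrite eqxx mulr1 big1 ?addr0 // => s /negPf ->.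
  by rewrite mulr0 mul0r.
- move=> s [_] /= sN; rewrite big1 ?mul0r // => i _.
  case: eqP => [sE|_]; last by rewrite mulr0.
  by case: sN; rewrite mem_undup; apply/mapP; exists i; rewrite ?mem_enum.
Qed.

Lemma mdp_state_prob_expect_after (u : As -> R) (pi : Sigma -> At) s (k : nat) s' :
  mdp_state_prob (TMDP tau rho u) s pi k s' =
  expect_after (state_policy pi) k (fun y => (s' == y)%:R) s.
Proof.
elim: k s' => [|k IHk] s'; first by rewrite expect_after0.
rewrite expect_after_stateS /=.
under eq_fsbigr do rewrite IHk.
exact: fsbig_pushforward.
Qed.

Lemma mdp_value_TMDP (u : As -> R) (gamma : R) (pi : Sigma -> At) s :
  mdp_value (TMDP tau rho u) gamma pi s =
  val_policy tau rho u gamma (state_policy pi) s.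
Proof.
rewrite /mdp_value /val_policy; congr discounted_sum; apply/funext => k.
rewrite expect_student_action_prob.
under eq_fsbigr do rewrite mdp_state_prob_expect_after.
exact: fsbig_pushforward.
Qed.

(** * Bellman inequalities and optimality *)

Section Value.
Context (u : As -> R) (gamma : R).
Hypotheses (gamma_gt0 : 0 < gamma) (gamma_lt1 : gamma < 1).

Local Notation val := (val_policy tau rho u gamma).

Let M : R := \sum_a `|u a|.

Lemma normr_expect_reward_le sigma s (k : nat) :
  `|expect (student_action_prob tau rho sigma s k) u| <= M.
Proof.
rewrite expect_student_action_prob; apply: normr_expect_after_le => s'.
apply: normr_expect_le => a; rewrite /M (bigD1 a) //= lerDl.
by apply: sumr_ge0 => *.
Qed.

Lemma normr_val_policy_le sigma s : `|val sigma s| <= M / (1 - gamma).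
Proof. by apply: discounted_sum_bounded => // k; exact: normr_expect_reward_le. Qed.

(** The Bellman equation of a fixed policy: [discounted_sumS] with weights [rho s]. *)
Lemma val_policy_rec sigma s (t := sigma [::] s) :
  val sigma s = expect (rho s) u +
    gamma * expect (rho s) (fun a => val (policy_after sigma (a, t)) (tau s a t)).
Proof.
rewrite {1}/val_policy.
rewrite (@discounted_sumS _ _ gamma_gt0 gamma_lt1 As (rho s) _ (fun a k =>
  expect (student_action_prob tau rho (policy_after sigma (a, t)) (tau s a t) k) u) M).
- by rewrite expect_student_action_prob expect_after0.
- by move=> a k; exact: normr_expect_reward_le.
move=> k; rewrite expect_student_action_prob expect_afterS.
by apply: eq_bigr => a _; rewrite expect_student_action_prob.
Qed.

Let normrB_le (x y K L : R) : `|x| <= K -> `|y| <= L -> - (K + L) <= x - y.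
Proof.
rewrite !ler_norml => /andP[xK _] /andP[_ yL].
by rewrite opprD lerD // lerN2.
Qed.

Lemma val_policy_le_supersolution (V : Sigma -> R) (K : R) :
    (forall s, `|V s| <= K) ->
    (forall s t, expect (rho s) u + gamma * expect (rho s) (fun a => V (tau s a t)) <= V s) ->
  forall sigma s, val sigma s <= V s.
Proof.
move=> VK Vsup sigma s; rewrite -subr_ge0.
(* The defect is indexed by pairs, as one step changes both the state and the policy. *)
pose D (p : teaching_policy Sigma As At * Sigma) := V p.2 - val p.1 p.2.
apply: (@nonneg_of_discounted _ _ gamma_gt0 gamma_lt1 _ D (K + M / (1 - gamma)) _ _ (sigma, s)).
  by move=> p; apply: normrB_le; [exact: VK | exact: normr_val_policy_le].
move=> c Dc [sigma' s'] {sigma s}; rewrite /D /= val_policy_rec.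
(* With the action that [sigma'] plays first, the immediate rewards cancel. *)
set t := sigma' [::] s'; apply: le_trans (lerB (Vsup s' t) (lexx _)).
rewrite opprD addrACA subrr add0r -mulrBr -expectB -mulrN ler_wpM2l //; first exact: ltW.
rewrite -[- c](expect_cst (rho s')); apply: ler_expect => a.
exact: (Dc (policy_after sigma' (a, t), tau s' a t)).
Qed.

(** The dual bound, needed for policy improvement. Indexing the defect by states suffices, since the
    policy is stationary. *)
Lemma subsolution_le_val_policy (V : Sigma -> R) (K : R) (pi : Sigma -> At) :
    (forall s, `|V s| <= K) ->
    (forall s, V s <= expect (rho s) u +
                      gamma * expect (rho s) (fun a => V (tau s a (pi s)))) ->
  forall s, V s <= val (state_policy pi) s.
Proof.
move=> VK Vsub s; rewrite -subr_ge0.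
pose D s := val (state_policy pi) s - V s.
apply: (@nonneg_of_discounted _ _ gamma_gt0 gamma_lt1 _ D (M / (1 - gamma) + K)) => {s}.
  by move=> s; apply: normrB_le; [exact: normr_val_policy_le | exact: VK].
move=> c Dc s; rewrite /D val_policy_rec.
apply: le_trans (lerB (lexx _) (Vsub s)).
rewrite opprD addrACA subrr add0r -mulrBr -expectB -mulrN ler_wpM2l //; first exact: ltW.
rewrite -[- c](expect_cst (rho s)); apply: ler_expect => a.
exact: (Dc (tau s a (pi s))).
Qed.

(* One step of policy improvement: compare [pi] with the policy that plays [t]
   at [s] and agrees with [pi] elsewhere. *)
Lemma gamma_optimal_supersolution (pi : Sigma -> At) :
    gamma_optimal (TMDP tau rho u) gamma pi ->
  forall s t, expect (rho s) u +
      gamma * expect (rho s) (fun a => val (state_policy pi) (tau s a t))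
    <= val (state_policy pi) s.
Proof.
move=> pi_opt s t; set V := val (state_policy pi); rewrite leNgt; apply/negP => Vs_lt.
pose pi' s' := if s' == s then t else pi s'.
(* [V] is a subsolution for [pi']: by [Vs_lt] at [s], and with equality elsewhere. *)
have V_le : forall s', V s' <= val (state_policy pi') s'.
  apply: subsolution_le_val_policy => s'; first exact: normr_val_policy_le.
  rewrite /pi'; case: eqP => [->|_]; first exact: ltW.
  by rewrite {1}/V val_policy_rec.
have := pi_opt s pi'; rewrite !mdp_value_TMDP leNgt => /negP; apply.
(* Unfolding the value of [pi'] once at [s] turns [V_le] into a strict gain there. *)
apply: (lt_le_trans Vs_lt); rewrite val_policy_rec /state_policy /pi' eqxx.
rewrite lerD2l ler_wpM2l //; first exact: ltW.
apply: ler_expect => a; exact: V_le.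
Qed.

End Value.
End Teaching.

Theorem theorem2 (R : realType) (Sigma : choiceType) (As At : finType)
    (hAs : (0 < #|As|)%N) (hAt : (0 < #|At|)%N)
    (u : As -> R) (gamma0 : R) (gamma0_gt0 : 0 < gamma0) (gamma0_lt1 : gamma0 < 1)
    (tau : Sigma -> As -> At -> Sigma) (rho : Sigma -> fdist R As)
    (pi : Sigma -> At) (hpi : gamma_optimal (TMDP tau rho u) gamma0 pi) :
  forall (s : Sigma) (sigma : teaching_policy Sigma As At),
    val_policy tau rho u gamma0 sigma s
      <= val_policy tau rho u gamma0 (state_policy pi) s.
Proof.
move=> s sigma.
apply: (val_policy_le_supersolution gamma0_gt0 gamma0_lt1) => [s'|].
  exact: normr_val_policy_le.
exact: gamma_optimal_supersolution.
Qed.
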